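(* Let $G$ be a finite group, let $S$ be a subset of $G$ with $|S| = d$, and let $\sigma$ be an automorphism of $G$. (1) Suppose $\sigma^{2}$ is the trivial automorphism of $G$. If the twisted Cayley graph $C(G,S)^\sigma$ is connected and undirected and $|G|\geq 4$, then the nontrivial spectrum of its normalised adjacency operator lies in the interval $$\left( -1 + \frac{h_\sigma^4}{2^{12}d^8},\ 1 - \frac{h_\sigma^2}{2d^2}\right],$$ where $h_\sigma$ denotes the vertex Cheeger constant of $C(G,S)^\sigma$. (2) Suppose $\sigma^{2k}$ is the trivial automorphism of $G$, where $k\geq 1$ is an odd integer. If the twisted Cayley graph $C(G,S)^\sigma$ is connected and undirected and $|G|\geq 4$, then the nontrivial spectrum of its normalised adjacency operator lies in the interval $$\left( \left( -1 + \frac{1}{2^{12} d^{8k}} \left( \frac12 \left( 1 - \left( 1 - \frac{h_\sigma^2}{2d^2} \right)^k \right) \right)^4 \right)^{1/k},\ 1 - \frac{h_\sigma^2}{2d^2} \right],$$ where $h_\sigma$ denotes the vertex Cheeger constant of $C(G,S)^\sigma$ and $x^{1/k}$ denotes the real $k$-th root of the real number $x$. (3) If the twisted Cayley sum graph $C_\Sigma(G,S)^\sigma$ is connected and undirected and $|G|\geq 4$, then the nontrivial spectrum of its normalised adjacency operator lies in the interval $$\left( -1 + \frac{h_{\Sigma,\sigma}^4}{2^{12}d^8},\ 1 - \frac{h_{\Sigma,\sigma}^2}{2d^2}\right],$$ where $h_{\Sigma,\sigma}$ denotes the vertex Cheeger constant of $C_\Sigma(G,S)^\sigma$.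
   Context: The twisted Cayley graph $C(G,S)^\sigma$ has vertex set $G$, and there is an edge from $x$ to $y$ if and only if $y=\sigma(xs)$ for some $s\in S$. The twisted Cayley sum graph $C_\Sigma(G,S)^\sigma$ has vertex set $G$, and there is an edge from $x$ to $y$ if and only if $y=\sigma(x^{-1}s)$ for some $s\in S$. Loops are allowed. Such a graph is called undirected if its edge relation is symmetric. When undirected, it is $d$-regular with $d=|S|$ (a loop at a vertex counts once towards its degree). The normalised adjacency operator of a $d$-regular graph on vertex set $V$ is $\frac1d$ times its adjacency matrix. The nontrivial spectrum of the normalised adjacency operator is the set of its eigenvalues other than $1$ and $-1$. (In a connected regular graph, $1$ is a simple eigenvalue, and $-1$ is an eigenvalue if and only if the graph is bipartite.) For a subset $V_1$ of the vertex set $V$, $N(V_1)$ is the set of vertices adjacent to some element of $V_1$, and $\partial(V_1)=N(V_1)\setminus V_1$. The vertex Cheeger constant is $$h=\inf\left\{\frac{|\partial(V_1)|}{|V_1|} : \emptyset\neq V_1\subseteq V,\ |V_1|\leq \frac{|V|}{2}\right\}.$$ *)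

(* Defs.v *)
From HB Require Import structures.
From mathcomp Require Import all_boot all_order all_algebra.
From mathcomp Require Import fingroup perm automorphism.
From mathcomp Require Import mathcomp_extra boolp classical_sets reals exp.

Set Implicit Arguments.
Unset Strict Implicit.
Unset Printing Implicit Defensive.

Import Order.TTheory GRing.Theory Num.Theory.

Local Open Scope ring_scope.

Section TwistedGraphs.
Variable gT : finGroupType.
Implicit Types (S : {set gT}) (sigma : {perm gT}).

Definition twisted_cayley S sigma : rel gT :=
  fun x y => [exists s in S, y == sigma (x * s)%g].

Definition twisted_cayley_sum S sigma : rel gT :=
  fun x y => [exists s in S, y == sigma (x^-1 * s)%g].

End TwistedGraphs.

Section Graphs.
Variables (R : realType) (T : finType).
Implicit Types (e : rel T) (V : {set T}).

Definition undirected e : Prop := symmetric e.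

(* For symmetric [e], [connect e] is undirected reachability. *)
Definition connected e : Prop := forall x y : T, connect e x y.

Definition neighbours e V : {set T} :=
  [set y | [exists x in V, e x y]].

Definition vertex_boundary e V : {set T} := neighbours e V :\: V.

Definition vertex_cheeger e : R :=
  inf [set r : R | exists V : {set T},
         [/\ V != finset.set0,
             #|V|%:R <= #|T|%:R / 2 :> R &
             r = #|vertex_boundary e V|%:R / #|V|%:R]]%classic.

(* Vertices are indexed through the enumeration of [T]; a loop contributes 1 on
   the diagonal. *)
Definition adjacency_mx e : 'M[R]_#|T| :=
  \matrix_(i, j) (e (enum_val i) (enum_val j))%:R.

Definition normalised_adjacency (d : nat) e : 'M[R]_#|T| :=
  d%:R^-1 *: adjacency_mx e.

(* [eigenvalue] is about row eigenvectors over [R]; for an undirected graph the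
   matrix is real symmetric, so this is its whole (two-sided, real) spectrum. *)
Definition nontrivial_spectrum (d : nat) e : set R :=
  [set l | [/\ eigenvalue (normalised_adjacency d e) l, l != 1 & l != -1]]%classic.

End Graphs.

Arguments vertex_cheeger R {T} e.
Arguments nontrivial_spectrum R {T} d e.

(* The real k-th root of a possibly negative real, for odd [k]; [powR] alone is
   not meant for negative bases. *)
Definition odd_root (R : realType) (k : nat) (x : R) : R :=
  Num.sg x * `|x| `^ k%:R^-1.

Lemma odd_rootK (R : realType) (k : nat) (x : R) :
  odd k -> odd_root k x ^+ k = x.
Proof.
move=> ok; have k0 : (k%:R : R) != 0 by rewrite pnatr_eq0; case: k ok.
have rootE : (`|x| `^ k%:R^-1) ^+ k = `|x|.
  by rewrite -powR_mulrn ?powR_ge0// -powRrM mulVf// powRr1.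
rewrite /odd_root exprMn rootE [RHS]numEsg; congr (_ * _).
have [_|_|_] := sgrP x; [|exact: expr1n|].
- by rewrite expr0n; case: k ok {k0 rootE}.
- by rewrite -signr_odd ok expr1.
Qed.

Lemma odd_root_unique (R : realType) (k : nat) (x y : R) :
  odd k -> y ^+ k = x -> odd_root k x = y.
Proof.
move=> ok <-; have k0 : (0 < k)%N by case: k ok.
suff inj : injective (fun z : R => z ^+ k) by apply: inj; rewrite odd_rootK.
have pos (a b : R) : 0 <= a -> a ^+ k = b ^+ k -> a = b.
  move=> a0 ab; have b0 : 0 <= b by rewrite -(exprn_odd_ge0 _ ok) -ab exprn_ge0.
  by apply/eqP; rewrite -(eqrXn2 k0 a0 b0) ab.
move=> a b /= ab; have [/pos/(_ ab)//|a0] := leP 0 a.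
apply: oppr_inj; apply: pos; first by rewrite oppr_ge0 ltW.
by rewrite [LHS]exprNn [RHS]exprNn ab.
Qed.

(* Main.v *)
Require Import Defs.
From HB Require Import structures.
From mathcomp Require Import all_boot all_order all_algebra.
From mathcomp Require Import fingroup perm automorphism.
From mathcomp Require Import mathcomp_extra boolp classical_sets reals exp.
From mathcomp Require Import ring lra zify.

Set Implicit Arguments.
Unset Strict Implicit.
Unset Printing Implicit Defensive.

Import Order.TTheory GRing.Theory Num.Theory.

Local Open Scope ring_scope.

(** The proof compares the graph with the kernel of an orthogonal projection.
Write [h] for the vertex Cheeger constant, [A] for the adjacency operator, and
[g = h ^ 2 / (2 d ^ 2)].

Upper bound.  The discrete Cheeger inequality, in the form of a Poincare
inequality
  h ^ 2 * (sum F ^ 2 - (sum F) ^ 2 / n) <= d * energy F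
valid for every function [F] ([poincare]), follows from the coarea inequality
[coarea] applied to the squares of the two halves of [F] cut at a median.  For
an eigenfunction of [A] with eigenvalue [d * l], [l != 1], the sum of [F]
vanishes and the energy is [2 d (1 - l) sum F ^ 2]; hence [l <= 1 - g].

Lower bound.  Left translations (right translations, in the case of sums) are
the first halves of two-fold automorphisms: pairs of permutations [(a, c)] such
that [x -> y] is an edge if and only if [a x -> c y] is one.  If [f] is an
eigenfunction for [l], then [f \o a - f \o c] is one for [- l].  When
[-1 < l < -1 + g], the upper bound prevents [- l] from being an eigenvalue, so
the eigenspace of [l] is stable under all translations
([eigenfunction_twofold]).  The kernel [P] of the orthogonal projection on it
is then translation invariant, and its diagonal is constant, equal to [m / n]
with [m] the dimension of the eigenspace ([kernel_diag]).

Now let [l] be close to [-1].  Across an edge the functions of the eigenspace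
nearly change sign, so their pairwise products are nearly invariant along the
edges, and by the Poincare inequality nearly constant.  Applying it to all
products [P x z * P x w] and summing over [z] and [w] gives
[h ^ 2 (m - 1) <= 4 d ^ 2 (1 + l) m], so that [m = 1] as soon as
[1 + l < g / 4] ([projection_rank_lt2]).  When [m = 1], the entries of [P] are
all equal to [1 / n] up to sign, and the eigenvalue equation shows that [d * l]
is an integer ([projection_integral]): since [l > -1], one gets
[l >= -1 + 1 / d].

Altogether [1 + l >= g / 4] or [1 + l >= 1 / d] ([eigenvalue_gap]), and each of
the lower bounds of the theorem is strictly weaker than this alternative. *)

(** * Cheeger and Poincare inequalities for regular graphs *)

Section Poincare.
Variables (R : realFieldType) (T : finType) (e : rel T).
Implicit Types (f g : T -> R) (V : {set T}).

Definition adjacency_op f (x : T) : R := \sum_y (e x y)%:R * f y.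

Definition energy f : R := \sum_x \sum_y (e x y)%:R * (f x - f y) ^+ 2.

Hypothesis e_sym : symmetric e.

Variable d : nat.
Hypothesis e_reg : forall x, \sum_y (e x y)%:R = d%:R :> R.

Lemma sum_edge_fst f : \sum_x \sum_y (e x y)%:R * f x = d%:R * \sum_x f x.
Proof.
by rewrite mulr_sumr; apply: eq_bigr => x _; rewrite -mulr_suml e_reg.
Qed.

Lemma sum_edge_snd f : \sum_x \sum_y (e x y)%:R * f y = d%:R * \sum_x f x.
Proof.
rewrite exchange_big -sum_edge_fst; apply: eq_bigr => x _.
by apply: eq_bigr => y _; rewrite e_sym.
Qed.

Lemma sum_edge_mul f : \sum_x \sum_y (e x y)%:R * (f x * f y) = \sum_x f x * adjacency_op f x.
Proof.
apply: eq_bigr => x _; rewrite mulr_sumr; apply: eq_bigr => y _; ring.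
Qed.

(** The cases [t = 1] and [t = -1] measure how far [f] is from changing sign,
respectively from being constant, along the edges. *)
Lemma sum_edge_add_sq (t : R) f :
  \sum_x \sum_y (e x y)%:R * (f x + t * f y) ^+ 2 =
  (1 + t ^+ 2) * (d%:R * \sum_x f x ^+ 2) + 2 * t * \sum_x f x * adjacency_op f x.
Proof.
have -> : (1 + t ^+ 2) * (d%:R * \sum_x f x ^+ 2) =
   \sum_x \sum_y (e x y)%:R * (f x ^+ 2) + t ^+ 2 * \sum_x \sum_y (e x y)%:R * (f y ^+ 2).
  by rewrite (sum_edge_fst (fun x => f x ^+ 2)) (sum_edge_snd (fun x => f x ^+ 2)); ring.
rewrite -sum_edge_mul !mulr_sumr -!big_split; apply: eq_bigr => x _ /=.
rewrite !mulr_sumr -!big_split; apply: eq_bigr => y _ /=; ring.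
Qed.

Lemma energyE f :
  energy f = 2 * (d%:R * \sum_x f x ^+ 2 - \sum_x f x * adjacency_op f x).
Proof.
transitivity (\sum_x \sum_y (e x y)%:R * (f x + -1 * f y) ^+ 2).
  by apply: eq_bigr => x _; apply: eq_bigr => y _; rewrite mulN1r.
rewrite sum_edge_add_sq; ring.
Qed.

Lemma sum_adj f : \sum_x adjacency_op f x = d%:R * \sum_x f x.
Proof. by rewrite -sum_edge_snd. Qed.

Variable h : R.
Hypothesis h_ge0 : 0 <= h.
Hypothesis h_expand : forall V, (2 * #|V| <= #|T|)%N ->
  h * #|V|%:R <= #|vertex_boundary e V|%:R.

(** Each boundary vertex of [V] receives at least one edge from [V]. *)
Lemma boundary_le_cut V :
  #|vertex_boundary e V|%:R <=
  \sum_x \sum_y (e x y)%:R * ((x \in V) && (y \notin V))%:R :> R.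
Proof.
rewrite exchange_big /= -sum1_card natr_sum big_mkcond ler_sum// => y _.
have nonneg P : 0 <= \sum_(x | P x) (e x y)%:R * ((x \in V) && (y \notin V))%:R :> R.
  by apply: sumr_ge0 => x _; rewrite mulr_ge0.
case: ifP => // /setDP[]; rewrite inE => /exists_inP[x xV exy] yV.
by rewrite (bigD1 x)//= ler_wpDr ?nonneg// exy xV yV mulr1.
Qed.

(** The function [g] is a positive combination of indicators of its level sets,
each of which has at least [h] times its size of edges leaving it.  The induction
on the size of the support subtracts one level at a time; the factor 2 comes
from counting every edge in both directions. *)
Lemma coarea g : (forall x, 0 <= g x) -> (2 * #|[set x | (g x != 0)%R]| <= #|T|)%N ->
  2 * h * \sum_x g x <= \sum_x \sum_y (e x y)%:R * `|g x - g y|.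
Proof.
have [n] := ubnP #|[set x | g x != 0]|; elim: n g => // n IHn g.
set V := [set x | g x != 0]; rewrite ltnS => Vn g0 Vhalf.
have [V0|[x1 x1V]] := set_0Vmem V.
  rewrite big1 ?mulr0; last first.
    move=> x _; apply/eqP; have : x \notin V by rewrite V0 inE.
    by rewrite inE negbK.
  by apply: sumr_ge0 => x _; apply: sumr_ge0 => y _; rewrite mulr_ge0.
(* [t] is the lowest positive level, [g'] what remains above it *)
have [x0 x0V' x0min] := arg_minP g x1V.
have {x0V'} x0V : x0 \in V := x0V'.
set t := g x0 in x0min.
have t0 : 0 <= t by exact: g0.
pose g' x := g x - t * (x \in V)%:R.
have gV x : x \notin V -> g x = 0 by rewrite inE negbK => /eqP.
have g'V x : x \notin V -> g' x = 0 by move=> xV; rewrite /g' gV// (negbTE xV) mulr0 subr0.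
have g'0 x : 0 <= g' x.
  have [xV|/g'V->//] := boolP (x \in V).
  by rewrite /g' xV mulr1 subr_ge0 x0min.
have sub : [set x | g' x != 0] \proper V.
  apply/properP; split; last first.
    by exists x0 => //; rewrite inE negbK /g' x0V mulr1 subrr.
  by apply/fintype.subsetP => x; rewrite inE; apply: contraNT => /g'V ->.
have IH : 2 * h * \sum_x g' x <= \sum_x \sum_y (e x y)%:R * `|g' x - g' y|.
  apply: IHn => //; first exact: leq_trans (proper_card sub) _.
  by apply: leq_trans Vhalf; rewrite leq_mul2l (subset_leq_card (proper_sub sub)).
have sumV : \sum_x (x \in V)%:R = #|V|%:R :> R.
  by rewrite -sum1_card natr_sum [RHS]big_mkcond; apply: eq_bigr => x _; case: ifP.
have gE : \sum_x g x = \sum_x g' x + t * #|V|%:R.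
  by rewrite -sumV mulr_sumr -big_split; apply: eq_bigr => x _ /=; rewrite /g' subrK.
pose cut x y : R := ((x \in V) && (y \notin V))%:R.
have absE x y : `|g x - g y| = `|g' x - g' y| + t * (cut x y + cut y x).
  rewrite /cut; have [xV|xV] := boolP (x \in V); have [yV|yV] := boolP (y \in V) => /=.
  - by rewrite /g' xV yV mulr1 addr0 mulr0 addr0; congr `|_|; ring.
  - by rewrite (gV y yV) (g'V y yV) !subr0 !ger0_norm// /g' xV addr0 subrK.
  - by rewrite (gV x xV) (g'V x xV) !sub0r !normrN !ger0_norm// /g' yV add0r subrK.
  - by rewrite !gV// !g'V// !addr0 mulr0 addr0.
have cutE : \sum_x \sum_y (e x y)%:R * (cut x y + cut y x) =
    2 * \sum_x \sum_y (e x y)%:R * cut x y.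
  rewrite mulr_natl mulr2n [X in _ = _ + X]exchange_big -big_split; apply: eq_bigr => x _ /=.
  rewrite -big_split; apply: eq_bigr => y _ /=; rewrite (e_sym y x); ring.
have -> : \sum_x \sum_y (e x y)%:R * `|g x - g y| =
    \sum_x \sum_y (e x y)%:R * `|g' x - g' y| +
    t * (2 * \sum_x \sum_y (e x y)%:R * cut x y).
  rewrite -cutE mulr_sumr -big_split; apply: eq_bigr => x _ /=.
  by rewrite mulr_sumr -big_split; apply: eq_bigr => y _ /=; rewrite absE; ring.
rewrite gE mulrDr lerD// mulrCA ler_wpM2l// -mulrA ler_wpM2l//.
exact: le_trans (h_expand Vhalf) (boundary_le_cut V).
Qed.

Hypothesis d_gt0 : (0 < d)%N.

(** The coarea inequality for [g ^ 2], where [g x ^ 2 - g y ^ 2] factors and the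
sum of the products is controlled by Cauchy-Schwarz. *)
Lemma poincare_small_support g :
  (forall x, 0 <= g x) -> (2 * #|[set x | (g x != 0)%R]| <= #|T|)%N ->
  h ^+ 2 * \sum_x g x ^+ 2 <= d%:R * energy g.
Proof.
move=> g0 supp.
have dR : 0 < d%:R :> R by rewrite ltr0n.
have co : 2 * h * \sum_x g x ^+ 2 <=
    \sum_x \sum_y (e x y)%:R * `|g x ^+ 2 - g y ^+ 2|.
  apply: (@coarea (fun x => g x ^+ 2)) => [x|]; first exact: sqr_ge0.
  by under eq_finset do rewrite expf_eq0.
have up : \sum_x \sum_y (e x y)%:R * (g x + g y) ^+ 2 <= 4 * d%:R * \sum_x g x ^+ 2.
  have := energyE g; have := sum_edge_add_sq 1 g.
  have : 0 <= energy g by do 2![apply: sumr_ge0 => ? _]; rewrite mulr_ge0 ?sqr_ge0.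
  under [in X in _ -> X -> _]eq_bigr do under eq_bigr do rewrite mul1r.
  by move=> ? -> ?; lra.
(* Cauchy-Schwarz, edge by edge: 4 d h |a| b <= (2 d |a|) ^ 2 + (h b) ^ 2 has
   the weights that are optimal in the extremal case *)
have amgm : 4 * d%:R * h * \sum_x \sum_y (e x y)%:R * `|g x ^+ 2 - g y ^+ 2| <=
    4 * d%:R ^+ 2 * energy g +
    h ^+ 2 * \sum_x \sum_y (e x y)%:R * (g x + g y) ^+ 2.
  rewrite !mulr_sumr -big_split; apply: ler_sum => x _ /=.
  rewrite !mulr_sumr -big_split; apply: ler_sum => y _ /=.
  rewrite subr_sqr normrM (ger0_norm (addr_ge0 (g0 x) (g0 y))) -(real_normK (num_real (g x - g y))).
  have := sqr_ge0 (2 * d%:R * `|g x - g y| - h * (g x + g y)).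
  by case: (e x y) => /=; rewrite ?mul0r ?mul1r ?mulr0 ?addr0//; nra.
suff : 4 * d%:R * (h ^+ 2 * \sum_x g x ^+ 2) <= 4 * d%:R * (d%:R * energy g).
  by rewrite ler_pM2l// mulr_gt0.
have := ler_wpM2l (mulr_ge0 (mulr_ge0 (ler0n R 4) (ltW dR)) h_ge0) co.
have := ler_wpM2l (sqr_ge0 h) up.
lra.
Qed.

(** Take for [c] the least value of [f] that at most half of the values exceed. *)
Lemma exists_median f : (0 < #|T|)%N ->
  exists c, (2 * #|[set x | (c < f x)%R]| <= #|T|)%N /\ (2 * #|[set x | (f x < c)%R]| <= #|T|)%N.
Proof.
move=> /card_gt0P[x1 _].
pose small := [pred x | 2 * #|[set z | (f x < f z)%R]| <= #|T|]%N.
have [x2 _ x2max] := @arg_maxP _ _ _ x1 predT f isT.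
have x2small : small x2.
  rewrite /= (_ : [set z | _] = finset.set0) ?cards0//.
  by apply/setP => z; rewrite !inE; apply/negbTE; rewrite -leNgt; exact: x2max.
have [x0 x0small x0min] := arg_minP f x2small.
exists (f x0); split=> //; rewrite leqNgt; apply/negP => big.
have [x3 x3B] : exists x, x \in [set x | f x < f x0].
  by apply/set0Pn; rewrite -card_gt0; lia.
have [x4 x4B' x4max] := arg_maxP f x3B.
have {x4B'} x4B : f x4 < f x0 by have : x4 \in [set x | f x < f x0] := x4B'; rewrite inE.
suff : small x4 by move=> /x0min; rewrite leNgt x4B.
rewrite /= (_ : [set z | _] = ~: [set x | f x < f x0]); last first.
  apply/setP => z; rewrite !inE; apply/idP/idP => [|zx0].
    apply: contraTN => zx0; rewrite -leNgt; apply: x4max.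
    by have : z \in [set x | f x < f x0] by rewrite inE.
  by apply: contraNT zx0; rewrite -leNgt => /le_lt_trans; apply.
move: (cardsC [set x | f x < f x0]) big.
by move: #|~: [set x | f x < f x0]| #|[set x | f x < f x0]| #|T| => a b n; lia.
Qed.

(** Cut [f] at a median: both halves have a small support, the energy of [f]
dominates the sum of theirs, and the sum of squares around any point [c] is at
least the one around the mean. *)
Lemma poincare f : (0 < #|T|)%N ->
  h ^+ 2 * (\sum_x f x ^+ 2 - (\sum_x f x) ^+ 2 / #|T|%:R) <= d%:R * energy f.
Proof.
move=> T0; have [c [hi lo]] := exists_median f T0.
pose gp x := Num.max (f x - c) 0; pose gn x := Num.max (c - f x) 0.
have gp0 x : 0 <= gp x by rewrite le_max lexx orbT.
have gn0 x : 0 <= gn x by rewrite le_max lexx orbT.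
have nT : 0 < #|T|%:R :> R by rewrite ltr0n.
have max0_neq0 (a : R) : (Num.max a 0 != 0) = (0 < a).
  have [a0|a0] := ltP 0 a; first by rewrite gt_eqF.
  by rewrite eqxx.
have suppP : [set x | gp x != 0] = [set x | c < f x].
  by apply/setP => x; rewrite !inE max0_neq0 subr_gt0.
have suppN : [set x | gn x != 0] = [set x | f x < c].
  by apply/setP => x; rewrite !inE max0_neq0 subr_gt0.
have := poincare_small_support gp0; rewrite suppP => /(_ hi) Pp.
have := poincare_small_support gn0; rewrite suppN => /(_ lo) Pn.
have sq x : gp x ^+ 2 + gn x ^+ 2 = f x ^+ 2 - 2 * c * f x + c ^+ 2.
  rewrite /gp /gn; have [cf|fc] := leP c (f x).
    by rewrite max_l ?max_r; [ring | lra..].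
  by rewrite max_r ?max_l; [ring | lra..].
have sumE : \sum_x gp x ^+ 2 + \sum_x gn x ^+ 2 =
    \sum_x f x ^+ 2 - 2 * c * (\sum_x f x) + #|T|%:R * c ^+ 2.
  rewrite -big_split /=; under eq_bigr do rewrite sq.
  by rewrite !big_split/= sumrN -mulr_sumr sumr_const -[c ^+ 2 *+ _]mulr_natl.
have en : energy gp + energy gn <= energy f.
  rewrite -big_split; apply: ler_sum => x _; rewrite -big_split; apply: ler_sum => y _ /=.
  rewrite -mulrDr ler_wpM2l// /gp /gn.
  have [cx|xc] := leP c (f x); have [cy|yc] := leP c (f y).
  - by rewrite !(@max_l _ _ (_ - c)) ?(@max_r _ _ (c - _)); [nra | lra..].
  - by rewrite (max_l (x := f x - c)) ?(max_r (x := f y - c)) ?(max_r (x := c - f x))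
       ?(max_l (x := c - f y)); [nra | lra..].
  - by rewrite (max_r (x := f x - c)) ?(max_l (x := f y - c)) ?(max_l (x := c - f x))
       ?(max_r (x := c - f y)); [nra | lra..].
  - by rewrite !(@max_r _ _ (_ - c)) ?(@max_l _ _ (c - _)); [nra | lra..].
have var : \sum_x f x ^+ 2 - (\sum_x f x) ^+ 2 / #|T|%:R <=
    \sum_x gp x ^+ 2 + \sum_x gn x ^+ 2.
  rewrite sumE; set s := \sum_x f x; set n := #|T|%:R.
  have : 0 <= (s - n * c) ^+ 2 / n by rewrite divr_ge0 ?sqr_ge0// ltW.
  suff -> : (s - n * c) ^+ 2 / n = s ^+ 2 / n - 2 * c * s + n * c ^+ 2 by lra.
  by field; rewrite gt_eqF.
have := ler_wpM2l (sqr_ge0 h) var.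
have := ler_wpM2l (ler0n R d) en.
lra.
Qed.

End Poincare.

(** * Orthogonal projection on an eigenspace *)

Section OrthogonalProjection.
Variables (R : realFieldType) (n : nat).

Lemma mulmx_trmx_eq0 (v : 'rV[R]_n) : v *m v^T = 0 -> v = 0.
Proof.
move=> /matrixP/(_ 0 0); rewrite !mxE => vv; apply/rowP => i; rewrite mxE.
have := psumr_eq0P _ vv => /(_ _ i isT).
rewrite !mxE => /(_ _)/eqP; rewrite mulf_eq0 orbb => /(_ _)/eqP; apply.
by move=> j _; rewrite mxE -expr2 sqr_ge0.
Qed.

(** The projector is [B^T (B B^T)^-1 B]: over an ordered field the Gram matrix
of independent rows is invertible, so that neither an orthonormal basis nor the
spectral theorem enters. *)
Lemma orthogonal_projector m (B : 'M[R]_(m, n)) : row_free B ->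
  exists P : 'M[R]_n, [/\ P^T = P, P *m P = P, (P <= B)%MS,
    forall v : 'rV_n, (v <= B)%MS -> v *m P = v & \tr P = m%:R].
Proof.
move=> Bfree; pose G := B *m B^T.
have Gu : G \in unitmx.
  rewrite -row_free_unit -kermx_eq0; apply/eqP/row_matrixP => i; rewrite row0.
  have : row i (kermx G) *m G = 0 by rewrite -row_mul mulmx_ker row0.
  set v := row i _ => vG; have vB : v *m B = 0.
    by apply: mulmx_trmx_eq0; rewrite trmx_mul mulmxA -(mulmxA v) vG mul0mx.
  by apply/eqP; rewrite -(mulmx_free_eq0 v Bfree) vB.
exists (B^T *m invmx G *m B); split.
- by rewrite !trmx_mul trmxK trmx_inv /G trmx_mul trmxK mulmxA.
- by rewrite !mulmxA -(mulmxA _ B B^T) -/G -(mulmxA _ G) mulmxV// mulmx1.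
- exact: submxMl.
- by move=> v /submxP[w ->]; rewrite !mulmxA -(mulmxA _ B B^T) -/G -(mulmxA _ G) mulmxV// mulmx1.
- by rewrite mxtrace_mulC mulmxA -/G mulmxV// mxtrace1.
Qed.

End OrthogonalProjection.

Section EigenKernel.
Variables (R : realType) (T : finType) (e : rel T).
Hypothesis e_sym : symmetric e.

Definition eigenfunction (mu : R) (f : T -> R) : Prop :=
  forall x, adjacency_op e f x = mu * f x.

Lemma sum_enum_rank (F : 'I_#|T| -> R) : \sum_i F i = \sum_x F (enum_rank x).
Proof. by rewrite (reindex (@enum_rank T))//; exact/onW_bij/enum_rank_bij. Qed.

Lemma row_eigenfunction (v : 'rV[R]_#|T|) mu : v *m (adjacency_mx R e) = mu *: v ->
  eigenfunction mu (fun x => v 0 (enum_rank x)).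
Proof.
move=> /rowP vE x; have := vE (enum_rank x); rewrite !mxE => <-.
rewrite sum_enum_rank; apply: eq_bigr => y _.
by rewrite mxE !enum_rankK e_sym mulrC.
Qed.

Lemma eigenfunction_row mu f : eigenfunction mu f ->
  (\row_i f (enum_val i)) *m (adjacency_mx R e) = mu *: \row_i f (enum_val i).
Proof.
move=> fE; apply/rowP => i; rewrite !mxE -fE sum_enum_rank; apply: eq_bigr => y _.
by rewrite !mxE !enum_rankK e_sym mulrC.
Qed.

(** The orthogonal projector on the eigenspace, as a function on pairs of
vertices; the symmetry of [P] is contained in the first property. *)
Lemma eigenspace_kernel (mu : R) : exists (P : T -> T -> R) (m : nat),
  [/\ forall x y, \sum_z P x z * P y z = P x y,
      forall x, eigenfunction mu (P x),
      forall f, eigenfunction mu f -> forall x, \sum_y P x y * f y = f x &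
      \sum_x P x x = m%:R].
Proof.
have [P [Psym Pidem Psub Pfix Ptr]] :=
  orthogonal_projector (row_base_free (eigenspace (adjacency_mx R e) mu)).
have PsymE i j : P i j = P j i by rewrite -[in LHS]Psym mxE.
exists (fun x y => P (enum_rank x) (enum_rank y)),
  (\rank (eigenspace (adjacency_mx R e) mu)); split.
- move=> x y; rewrite -(sum_enum_rank (fun i => P (enum_rank x) i * P (enum_rank y) i)).
  rewrite -[in RHS]Pidem mxE; apply: eq_bigr => i _; by rewrite (PsymE i).
- move=> x y; have := @row_eigenfunction (row (enum_rank x) P) mu.
  have -> : (fun x0 => row (enum_rank x) P 0 (enum_rank x0)) =
     (fun y => P (enum_rank x) (enum_rank y)).
    by apply/funext => z; rewrite mxE.
  apply; apply/eigenspaceP.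
  by apply: submx_trans (row_sub _ _) (submx_trans Psub _); rewrite eq_row_base.
- move=> f /eigenfunction_row fE x.
  have /Pfix/rowP/(_ (enum_rank x)) : 
      (\row_i f (enum_val i) <= row_base (eigenspace (adjacency_mx R e) mu))%MS.
    by rewrite eq_row_base; apply/eigenspaceP.
  rewrite !mxE enum_rankK => <-.
  rewrite sum_enum_rank; apply: eq_bigr => y _.
  by rewrite mxE enum_rankK PsymE mulrC.
- by rewrite -Ptr /mxtrace sum_enum_rank.
Qed.

End EigenKernel.

(** * Eigenvalues of regular expanding graphs *)

Section RegularSpectrum.
Variables (R : realType) (T : finType) (e : rel T) (d : nat).
Hypothesis e_sym : symmetric e.
Hypothesis d_gt0 : (0 < d)%N.
Hypothesis e_reg : forall x, \sum_y (e x y)%:R = d%:R :> R.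
Variable h : R.
Hypothesis h_ge0 : 0 <= h.
Hypothesis h_expand : forall V : {set T}, (2 * #|V| <= #|T|)%N ->
  h * #|V|%:R <= #|vertex_boundary e V|%:R.
Implicit Types (f : T -> R) (l : R).

Let dR : 0 < d%:R :> R. Proof. by rewrite ltr0n. Qed.

Lemma sum_sq_gt0 f : (exists x, f x != 0) -> 0 < \sum_x f x ^+ 2.
Proof.
move=> [x fx]; rewrite (bigD1 x)//= ltr_pwDl ?exprn_even_gt0 ?fx ?orbT//.
by apply: sumr_ge0 => y _; exact: sqr_ge0.
Qed.

Lemma sum_eigenfunction l f : eigenfunction e (d%:R * l) f ->
  \sum_x f x * adjacency_op e f x = d%:R * l * \sum_x f x ^+ 2.
Proof. by move=> fE; rewrite mulr_sumr; apply: eq_bigr => x _; rewrite fE; ring. Qed.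

Lemma eigenvalue_le l f : eigenfunction e (d%:R * l) f -> (exists x, f x != 0) ->
  l != 1 -> l <= 1 - h ^+ 2 / (2 * d%:R ^+ 2).
Proof.
move=> fE fn0 l1; have f2 := sum_sq_gt0 fn0.
have T0 : (0 < #|T|)%N by case: fn0 => x _; apply/card_gt0P; exists x.
have sum0 : \sum_x f x = 0.
  have := sum_adj e_sym e_reg f; under eq_bigr do rewrite fE.
  rewrite -mulr_sumr -mulrA => /(mulfI (lt0r_neq0 dR))/eqP.
  by rewrite -subr_eq0 -{2}[\sum_x f x]mul1r -mulrBl mulf_eq0 subr_eq0 (negbTE l1) => /eqP.
have := poincare e_sym e_reg h_ge0 h_expand d_gt0 f T0.
rewrite sum0 expr0n mul0r subr0 (energyE e_sym e_reg) (sum_eigenfunction fE).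
set s := \sum_x _ in f2 * => P.
have : h ^+ 2 <= (1 - l) * (2 * d%:R ^+ 2).
  by rewrite -(ler_pM2r f2); apply: le_trans P _; rewrite le_eqVlt;
    apply/orP; left; apply/eqP; ring.
rewrite -ler_pdivrMr; first by move=> ?; lra.
by rewrite mulr_gt0 ?exprn_gt0.
Qed.

Lemma eigenvalue_ge l f : eigenfunction e (d%:R * l) f -> (exists x, f x != 0) -> -1 <= l.
Proof.
move=> fE /sum_sq_gt0 f2; have := sum_edge_add_sq e_sym e_reg 1 f.
rewrite (sum_eigenfunction fE).
have : 0 <= \sum_x \sum_y (e x y)%:R * (f x + 1 * f y) ^+ 2.
  by do 2![apply: sumr_ge0 => ? _]; rewrite mulr_ge0 ?sqr_ge0.
move=> /[swap] ->.
set s := \sum_x _ in f2 *.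
have -> : (1 + 1 ^+ 2) * (d%:R * s) + 2 * 1 * (d%:R * l * s) = 2 * (d%:R * s) * (1 + l) by ring.
rewrite pmulr_rge0 ?mulr_gt0// => ?; lra.
Qed.

(** These pairs are the automorphisms of the bipartite double cover that
preserve its two halves.  Twisted graphs have many of them, although
translations are not automorphisms of these graphs in general. *)
Definition twofold_automorphism (a c : {perm T}) : Prop :=
  forall x y, e (a x) (c y) = e x y.

Lemma adj_twofold (a c : {perm T}) f x : twofold_automorphism a c ->
  adjacency_op e (f \o c) x = adjacency_op e f (a x).
Proof.
move=> ac; rewrite /adjacency_op [RHS](reindex_inj (@perm_inj _ c)) /=.
by apply: eq_bigr => y _; rewrite ac.
Qed.

(** The adjacency operator exchanges [f \o a] and [f \o c] up to the factor
[d * l], so it multiplies their difference by [- d * l]. *)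
Lemma eigenfunction_twofold (a c : {perm T}) l f : twofold_automorphism a c ->
  (forall w, eigenfunction e (d%:R * - l) w -> forall x, w x = 0) ->
  eigenfunction e (d%:R * l) f -> eigenfunction e (d%:R * l) (f \o a).
Proof.
move=> ac noneg fE.
have ca : twofold_automorphism c a by move=> x y; rewrite e_sym ac e_sym.
have fa x : adjacency_op e (f \o a) x = d%:R * l * f (c x) by rewrite (adj_twofold _ _ ca) fE.
have fc x : adjacency_op e (f \o c) x = d%:R * l * f (a x) by rewrite (adj_twofold _ _ ac) fE.
have w0 : forall x, f (a x) - f (c x) = 0.
  apply: noneg => x; transitivity (adjacency_op e (f \o a) x - adjacency_op e (f \o c) x).
    by rewrite -sumrB; apply: eq_bigr => y _; rewrite -mulrBr.
  rewrite fa fc; ring.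
by move=> x; rewrite fa /=; have /eqP := w0 x; rewrite subr_eq0 => /eqP ->.
Qed.

Section Projection.
Variables (l : R) (P : T -> T -> R) (m : nat).
Hypothesis P_idem : forall x y, \sum_z P x z * P y z = P x y.
Hypothesis P_eig : forall x, eigenfunction e (d%:R * l) (P x).
Hypothesis P_repr : forall f, eigenfunction e (d%:R * l) f ->
  forall x, \sum_y P x y * f y = f x.
Hypothesis P_tr : \sum_x P x x = m%:R.

Lemma kernel_sym x y : P x y = P y x.
Proof. by rewrite -P_idem -[RHS]P_idem; apply: eq_bigr => z _; rewrite mulrC. Qed.

(** The translated kernel is the orthogonal projector on the translated
eigenspace, which is the same eigenspace; [P] and its translate [P'] agree, as
both equal the product [P P']. *)
Lemma kernel_invariant (a c : {perm T}) : twofold_automorphism a c ->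
  (forall w, eigenfunction e (d%:R * - l) w -> forall x, w x = 0) ->
  forall x y, P (a x) (a y) = P x y.
Proof.
move=> ac noneg x y.
have acV : twofold_automorphism a^-1 c^-1.
  by move=> u v; rewrite -{2}(permKV a u) -{2}(permKV c v) ac.
have Ea := eigenfunction_twofold ac noneg (P_eig (a y)).
have EaV := eigenfunction_twofold acV noneg (P_eig x).
transitivity (\sum_z P x z * P (a y) (a z)).
  by rewrite (P_repr Ea) /= kernel_sym.
transitivity (\sum_z P (a y) z * P x ((a^-1)%g z)).
  rewrite [RHS](reindex_inj (@perm_inj _ a)) /=.
  by apply: eq_bigr => z _; rewrite permK mulrC.
by rewrite (P_repr EaV) /= permK.
Qed.

Hypothesis transitive : forall x y, exists a c : {perm T}, a x = y /\ twofold_automorphism a c.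
Hypothesis l_gt : 1 + l < h ^+ 2 / (8 * d%:R ^+ 2).
Hypothesis l_gtN1 : -1 < l.

(** An eigenvalue [- l] would be too close to 1 for the Cheeger inequality. *)
Lemma no_opposite_eigenfunction w : eigenfunction e (d%:R * - l) w -> forall x, w x = 0.
Proof.
move=> wE x; apply/eqP/negP => /negP wx.
have := eigenvalue_le wE (ex_intro _ x wx).
have dd : 0 < d%:R ^+ 2 :> R by rewrite exprn_gt0.
have gapE : h ^+ 2 / (2 * d%:R ^+ 2) = 4 * (h ^+ 2 / (8 * d%:R ^+ 2)).
  by field; exact: lt0r_neq0.
rewrite gapE; have l1 : - l != 1 by rewrite eqr_oppLR gt_eqF.
by move=> /(_ l1); move: l_gt l_gtN1; set q := h ^+ 2 / _ => *; lra.
Qed.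

Hypothesis T_gt0 : (0 < #|T|)%N.
Let p : R := m%:R / #|T|%:R.
Let nT : 0 < #|T|%:R :> R. Proof. by rewrite ltr0n. Qed.

Lemma kernel_diag x : P x x = p.
Proof.
have const y : P y y = P x x.
  have [a [c [<- ac]]] := transitive x y.
  exact: kernel_invariant ac no_opposite_eigenfunction _ _.
apply: (mulfI (lt0r_neq0 nT)); rewrite /p mulrCA divff ?lt0r_neq0// mulr1 -P_tr.
by under eq_bigr do rewrite const; rewrite sumr_const mulr_natl.
Qed.

(** Cauchy-Schwarz for the positive semidefinite kernel [P]. *)
Lemma kernel_le x y : `|P x y| <= p.
Proof.
have ge0 s : s ^+ 2 = 1 -> 0 <= p + s * P x y.
  move=> s2; have : 0 <= \sum_z (P x z + s * P y z) ^+ 2 by apply: sumr_ge0 => z _; exact: sqr_ge0.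
  have -> : \sum_z (P x z + s * P y z) ^+ 2 =
     \sum_z P x z * P x z + s ^+ 2 * (\sum_z P y z * P y z) + 2 * s * \sum_z P x z * P y z.
    by rewrite !mulr_sumr -!big_split; apply: eq_bigr => z _ /=; ring.
  by rewrite !P_idem !kernel_diag s2; lra.
have := ge0 1 (expr1n _ _); have := ge0 (-1); rewrite sqrrN expr1n => /(_ erefl).
by rewrite ler_norml => ? ?; apply/andP; split; lra.
Qed.

(** The functions [F z w] play the role of the pairwise products of an
orthonormal basis of the eigenspace.  The squared norms of these products add
up to [p * m]; only the product of a basis function with itself has a nonzero
mean, and these means contribute [p], so the total variance is [p * (m - 1)].
The total energy is the sum over the edges of
[2 (p ^ 2 - P x y ^ 2)]: it is small because [P x y] is close to [- p] on the
edges when [l] is close to [-1]. *)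
Lemma projection_rank_lt2 : (m < 2)%N.
Proof.
have p0 : 0 <= p by rewrite divr_ge0// ler0n.
have pn : #|T|%:R * p = m%:R by rewrite mulrC divfK// lt0r_neq0.
pose F z w x := P x z * P x w.
have sumF z w : \sum_x F z w x = P z w.
  by rewrite -P_idem; apply: eq_bigr => x _; rewrite /F (kernel_sym x) (kernel_sym x).
have dotF x y : \sum_z \sum_w F z w x * F z w y = P x y ^+ 2.
  rewrite expr2 -{1}P_idem mulr_suml; apply: eq_bigr => z _.
  by rewrite -[P x y]P_idem mulr_sumr; apply: eq_bigr => w _; rewrite /F; ring.
have sumP2 : \sum_z \sum_w P z w ^+ 2 = m%:R.
  by rewrite -P_tr; apply: eq_bigr => z _; rewrite -P_idem; apply: eq_bigr => w _; rewrite expr2.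
have lhs : \sum_z \sum_w (\sum_x F z w x ^+ 2 - (\sum_x F z w x) ^+ 2 / #|T|%:R) =
    p * (m%:R - 1).
  transitivity (\sum_x \sum_z \sum_w F z w x * F z w x - (\sum_z \sum_w P z w ^+ 2) / #|T|%:R).
    rewrite [X in _ = X - _]exchange_big /= mulr_suml -sumrB; apply: eq_bigr => z _.
    rewrite [X in _ = X - _]exchange_big /= mulr_suml -sumrB; apply: eq_bigr => w _.
    by rewrite sumF; congr (_ - _); apply: eq_bigr => x _; rewrite expr2.
  under eq_bigr do rewrite dotF kernel_diag.
  by rewrite sumP2 -/p sumr_const -[_ *+ #|_|]mulr_natl -pn; ring.
have rhs : \sum_z \sum_w energy e (F z w) <= 4 * d%:R * p * m%:R * (1 + l).
  have -> : \sum_z \sum_w energy e (F z w) =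
      \sum_x \sum_y (e x y)%:R * (2 * (p ^+ 2 - P x y ^+ 2)).
    rewrite /energy; under eq_bigr do rewrite exchange_big /=.
    rewrite exchange_big; apply: eq_bigr => x _ /=.
    under eq_bigr do rewrite exchange_big /=.
    rewrite exchange_big; apply: eq_bigr => y _ /=.
    transitivity ((e x y)%:R * (\sum_z \sum_w F z w x * F z w x +
       \sum_z \sum_w F z w y * F z w y - 2 * \sum_z \sum_w F z w x * F z w y)).
      rewrite !mulr_sumr -big_split -sumrB mulr_sumr; apply: eq_bigr => z _ /=.
      rewrite !mulr_sumr -big_split -sumrB mulr_sumr; apply: eq_bigr => w _ /=.
      ring.
    by rewrite !dotF !kernel_diag; ring.
  have -> : 4 * d%:R * p * m%:R * (1 + l) =
      \sum_x \sum_y (e x y)%:R * (4 * p * (p + P x y)).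
    transitivity (4 * p * (\sum_x \sum_y (e x y)%:R * p + \sum_x adjacency_op e (P x) x)).
      have -> : \sum_x adjacency_op e (P x) x = d%:R * l * m%:R.
        by rewrite -P_tr mulr_sumr; apply: eq_bigr => x _; rewrite P_eig.
      by rewrite (sum_edge_fst e_reg (fun=> p)) sumr_const -[_ *+ #|_|]mulr_natl -pn; ring.
    rewrite -big_split mulr_sumr; apply: eq_bigr => x _ /=.
    by rewrite -big_split mulr_sumr; apply: eq_bigr => y _ /=; ring.
  apply: ler_sum => x _; apply: ler_sum => y _; rewrite ler_wpM2l//.
  (* p ^ 2 - P ^ 2 = (p - P) (p + P) with p - P <= 2 p *)
  by have := kernel_le x y; rewrite ler_norml => /andP[? ?]; nra.
have : h ^+ 2 * (p * (m%:R - 1)) <= d%:R * (4 * d%:R * p * m%:R * (1 + l)).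
  apply: le_trans (ler_wpM2l (ltW dR) rhs).
  rewrite -lhs !mulr_sumr; apply: ler_sum => z _; rewrite !mulr_sumr.
  by apply: ler_sum => w _; exact: (poincare e_sym e_reg h_ge0 h_expand d_gt0).
rewrite ltnNge; move=> main; apply/negP => m2.
have m2R : 2 <= m%:R :> R by rewrite ler_nat.
have p_gt0 : 0 < p by rewrite divr_gt0//; lra.
move: l_gt; rewrite ltr_pdivlMr ?mulr_gt0 ?exprn_gt0// => l_gt'.
have : h ^+ 2 * (m%:R - 1) <= 4 * d%:R ^+ 2 * m%:R * (1 + l).
  rewrite -(ler_pM2l p_gt0); move: main; set X := (X in X <= _); set Y := (X in _ <= X -> _).
  by move=> XY; apply: le_trans (le_trans XY _); rewrite /X /Y le_eqVlt;
    apply/orP; left; apply/eqP; ring.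
set q := d%:R ^+ 2 in l_gt' *.
have h2 : 0 <= h ^+ 2 by exact: sqr_ge0.
nra.
Qed.

(** For [m = 1], the row [P x] has sum of squares [p = n * p ^ 2] while all its
entries are at most [p] in absolute value: they all are [p] or [- p].  The
eigenvalue equation at [x] then writes [d * l] as a sum of signs. *)
Lemma projection_integral : (0 < m)%N -> exists k : int, d%:R * l = k%:~R.
Proof.
move=> m0; have m1 : m = 1%N by have := projection_rank_lt2; lia.
have pE : p = #|T|%:R^-1 by rewrite /p m1 div1r.
have p_gt0 : 0 < p by rewrite pE invr_gt0.
have /card_gt0P[x _] := T_gt0.
have Pabs y : P x y ^+ 2 = p ^+ 2.
  have le z : 0 <= p ^+ 2 - P x z ^+ 2.
    have := kernel_le x z; rewrite ler_norml => /andP[? ?]; nra.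
  have s0 : \sum_z (p ^+ 2 - P x z ^+ 2) = 0.
    rewrite sumrB sumr_const -[_ *+ #|_|]mulr_natl.
    under [X in _ - X]eq_bigr do rewrite expr2.
    by rewrite P_idem kernel_diag pE expr2 mulrA divff ?mul1r ?subrr ?lt0r_neq0.
  have : p ^+ 2 - P x y ^+ 2 = 0 by apply: (psumr_eq0P _ s0).
  by move=> /eqP; rewrite subr_eq0 => /eqP.
pose s y : int := if P x y == p then 1 else -1.
have PE y : P x y = p * (s y)%:~R.
  rewrite /s; case: eqP => [->|/eqP ne]; first by rewrite mulr1.
  have /eqP := Pabs y; rewrite eqf_sqr (negbTE ne) /= => /eqP ->.
  by rewrite mulrN1.
exists (\sum_y (e x y)%:R * s y); apply: (mulfI (lt0r_neq0 p_gt0)).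
have := P_eig x x; rewrite kernel_diag mulrC => <-.
rewrite rmorph_sum mulr_sumr; apply: eq_bigr => y _.
by rewrite PE rmorphM /= mulrz_nat; ring.
Qed.

End Projection.

(** If both alternatives failed, [d * (1 + l)] would be an integer strictly
between 0 and 1. *)
Theorem eigenvalue_gap l f :
  (forall x y, exists a c : {perm T}, a x = y /\ twofold_automorphism a c) ->
  eigenfunction e (d%:R * l) f -> (exists x, f x != 0) -> l != -1 ->
  h ^+ 2 / (8 * d%:R ^+ 2) <= 1 + l \/ d%:R^-1 <= 1 + l.
Proof.
move=> trans fE fn0 lN1.
have lgt : -1 < l by rewrite lt_neqAle eq_sym lN1 (eigenvalue_ge fE).
have [|lgap] := leP; [by left | right].
have T0 : (0 < #|T|)%N by case: fn0 => x _; apply/card_gt0P; exists x.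
have [P [m [Pi Pe Pr Pt]]] := eigenspace_kernel e_sym (d%:R * l).
(* a projector of trace 0 vanishes, and would not fix [f] *)
have m0 : (0 < m)%N.
  rewrite lt0n; apply/negP => /eqP m0; case: fn0 => x /negP[].
  have Pxx z : P z z = 0.
    move: Pt; rewrite m0 => /psumr_eq0P; apply=> // y _.
    by rewrite -Pi; apply: sumr_ge0 => w _; rewrite -expr2 sqr_ge0.
  have Pxy y : P x y = 0.
    apply/eqP; rewrite -[_ == 0]orbb -mulf_eq0; apply/eqP.
    have := Pi x x; rewrite Pxx => /psumr_eq0P; apply=> // w _.
    by rewrite -expr2 sqr_ge0.
  by rewrite -(Pr f fE) big1// => y _; rewrite Pxy mul0r.
have [k kE] := projection_integral Pi Pe Pr Pt trans lgap lgt T0 m0.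
rewrite -(ler_pM2l dR) mulfV ?lt0r_neq0// mulrDr mulr1 kE.
have : 0 < d%:R * (1 + l) by rewrite mulr_gt0//; lra.
rewrite mulrDr mulr1 kE -[d%:R]/((d%:Z)%:~R) -intrD -[0]/(0%:~R) -[1]/(1%:~R).
by rewrite ltr_int ler_int; lia.
Qed.

End RegularSpectrum.

(** * The vertex Cheeger constant *)

Section SpectrumBounds.
Variables (R : realType) (T : finType) (e : rel T) (d : nat).
Hypothesis e_deg : forall x, #|[set y | e x y]| = d.

Lemma vertex_cheeger_ge0 : 0 <= vertex_cheeger R e.
Proof.
rewrite /vertex_cheeger; set E := (X in inf X).
have [->|/set0P E0] := eqVneq E classical_sets.set0; first by rewrite inf0.
by apply: lb_le_inf => // _ [V [_ _ ->]]; rewrite divr_ge0.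
Qed.

Lemma vertex_cheeger_expand (V : {set T}) : (2 * #|V| <= #|T|)%N ->
  vertex_cheeger R e * #|V|%:R <= #|vertex_boundary e V|%:R.
Proof.
have [->|V0] := eqVneq V finset.set0; first by rewrite cards0 mulr0.
move=> Vhalf; rewrite -ler_pdivlMr ?ltr0n ?card_gt0//; apply: ge_inf.
  by exists 0 => _ [W [_ _ ->]]; rewrite divr_ge0.
by exists V; split=> //; rewrite ler_pdivlMr// mulrC -natrM ler_nat.
Qed.

(** Test the infimum on a single vertex. *)
Lemma vertex_cheeger_le_degree : (2 <= #|T|)%N -> vertex_cheeger R e <= d%:R.
Proof.
move=> T2; have /card_gt0P[x _] := ltnW T2.
have := @vertex_cheeger_expand [set x]; rewrite cards1 mulr1 => /(_ T2)/le_trans; apply.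
rewrite ler_nat -(e_deg x) subset_leq_card//; apply/fintype.subsetP => y.
by rewrite !inE => /andP[_ /exists_inP[z]]; rewrite inE => /eqP ->.
Qed.

Lemma connected_degree_gt0 : connected e -> (2 <= #|T|)%N -> (0 < d)%N.
Proof.
move=> e_conn /card_gt1P[x [y [_ _ xy]]].
have /connectP[[/=|z p /= /andP[exz _] _]] := e_conn x y.
  by move=> _ yx; rewrite yx eqxx in xy.
by rewrite -(e_deg x) card_gt0; apply/set0Pn; exists z; rewrite inE.
Qed.

Lemma nontrivial_spectrum_bounds (l : R) :
  connected e -> symmetric e -> (2 <= #|T|)%N ->
  (forall x y, exists a c : {perm T}, a x = y /\ twofold_automorphism e a c) ->
  nontrivial_spectrum R d e l ->
  let g := vertex_cheeger R e ^+ 2 / (2 * d%:R ^+ 2) in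
  [/\ -1 < l, l <= 1 - g, 0 <= g <= 1 / 2 & g / 4 <= 1 + l \/ d%:R^-1 <= 1 + l].
Proof.
move=> e_conn e_sym T2 trans [/eigenvalueP[v vE v0] l1 lN1] g.
have d0 := connected_degree_gt0 e_conn T2.
have dR : 0 < d%:R :> R by rewrite ltr0n.
have reg x : \sum_y (e x y)%:R = d%:R :> R.
  rewrite -(e_deg x) -sum1_card natr_sum [RHS]big_mkcond.
  by apply: eq_bigr => y _; rewrite inE; case: ifP.
have vE' : v *m adjacency_mx R e = (d%:R * l) *: v.
  by rewrite -scalerA -vE -scalemxAr scalerA mulfV ?lt0r_neq0// scale1r.
have fE := row_eigenfunction e_sym vE'.
have fn0 : exists x, v 0 (enum_rank x) != 0.
  have /rV0Pn[i vi] := v0; by exists (enum_val i); rewrite enum_valK.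
have gap := eigenvalue_gap e_sym d0 reg vertex_cheeger_ge0 vertex_cheeger_expand trans fE fn0 lN1.
have gE : g / 4 = vertex_cheeger R e ^+ 2 / (8 * d%:R ^+ 2).
  by rewrite /g; field; exact: lt0r_neq0.
split.
- by rewrite lt_neqAle eq_sym lN1 (eigenvalue_ge e_sym d0 reg fE).
- exact: (eigenvalue_le e_sym d0 reg vertex_cheeger_ge0 vertex_cheeger_expand fE).
- apply/andP; split; first by rewrite divr_ge0 ?sqr_ge0 ?mulr_ge0 ?sqr_ge0.
  rewrite ler_pdivrMr ?mulr_gt0 ?exprn_gt0//.
  have -> : 1 / 2 * (2 * d%:R ^+ 2) = d%:R ^+ 2 :> R by field.
  by rewrite ler_sqr ?nnegrE ?vertex_cheeger_ge0// vertex_cheeger_le_degree.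
- by rewrite gE.
Qed.

End SpectrumBounds.

(** * Comparison with the stated lower bounds *)

Section Numerics.
Variable R : realType.
Implicit Types (l g b : R).

Lemma ler_odd_exp (k : nat) (a b : R) : odd k -> a <= b -> a ^+ k <= b ^+ k.
Proof.
move=> ok ab; have [a0|a0] := leP 0 a.
  by rewrite lerXn2r// nnegrE// (le_trans a0).
have [b0|b0] := leP 0 b.
  by rewrite (@le_trans _ _ 0)// ?exprn_odd_le0 ?exprn_odd_ge0// ltW.
rewrite -lerN2 -[a]opprK -[b]opprK !(exprNn (- _)) -signr_odd ok expr1 !mulN1r !opprK.
by rewrite lerXn2r ?nnegrE ?oppr_ge0 ?lerN2// ltW.
Qed.

Lemma odd_root_lt (k : nat) (x l : R) : odd k -> x < l ^+ k -> odd_root k x < l.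
Proof.
move=> ok xl; rewrite ltNge; apply/negP => /(ler_odd_exp ok).
by rewrite odd_rootK// leNgt xl.
Qed.

(** [1 - (1 - b) ^ k] is concave in [b] on [[0, 1]] and vanishes at 0. *)
Lemma one_sub_exp_le4 (k : nat) g : 0 <= g <= 1 ->
  0 <= 1 - (1 - g) ^+ k <= 4 * (1 - (1 - g / 4) ^+ k).
Proof.
move=> /andP[g0 g1]; elim: k => [|k /andP[IH0 IH1]]; first by rewrite !expr0 subrr mulr0 lexx.
rewrite !exprS; set u := (1 - g) ^+ k in IH0 IH1 *; set v := (1 - g / 4) ^+ k in IH1 *.
apply/andP; split; nra.
Qed.

Lemma one_sub_exp_ge (k : nat) b : (0 < k)%N -> 0 <= b <= 1 -> b <= 1 - (1 - b) ^+ k.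
Proof.
case: k => // k _ /andP[b0 b1]; rewrite exprS.
have : (1 - b) ^+ k <= 1 by rewrite exprn_ile1//; lra.
have : 0 <= (1 - b) ^+ k by rewrite exprn_ge0//; lra.
nra.
Qed.

Variable d : nat.
Hypothesis d_gt0 : (0 < d)%N.
Variables (l g : R).
Hypothesis l_gtN1 : -1 < l.
Hypothesis g_bounds : 0 <= g <= 1 / 2.
Hypothesis gap : g / 4 <= 1 + l \/ d%:R^-1 <= 1 + l.

Let invd : 0 < (d%:R : R)^-1 <= 1.
Proof. by rewrite invr_gt0 ltr0n d_gt0 invf_le1 ?ltr0n// ler1n. Qed.

(** The quantity squared on the left is at most [g], [1 / d] and 1, so an eighth
of its square is already below both alternatives, unless [g = 0], when
[l > -1] suffices. *)
Lemma lower_bound_quartic : -1 + (g * d%:R^-1 ^+ 2) ^+ 2 / 2 ^+ 10 < l.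
Proof.
move: l_gtN1 g_bounds gap invd => lN1 /andP[g0 g1] gp; set D := d%:R^-1 in gp * => /andP[D0 D1].
suff : (g * D ^+ 2) ^+ 2 / 2 ^+ 10 < 1 + l by lra.
rewrite ltr_pdivrMr ?exprn_gt0//.
have D2 : D ^+ 2 <= D by rewrite expr2 ger_pMr.
have D20 : 0 < D ^+ 2 by rewrite exprn_gt0.
have q0 : 0 <= g * D ^+ 2 by rewrite mulr_ge0// ltW.
have qg : g * D ^+ 2 <= g by nra.
have qD : g * D ^+ 2 <= D by nra.
have q2 : (g * D ^+ 2) ^+ 2 <= g * D ^+ 2 by nra.
set q := g * D ^+ 2 in q0 qg qD q2 *.
have c8 : 8 <= 2 ^+ 10 :> R.
  by apply: le_trans (_ : 2 ^+ 3 <= _); [lra | rewrite ler_weXn2l ?ler1n].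
set c := 2 ^+ 10 in c8 *.
case: gp => gp; nra.
Qed.

(** Compare [k]-th powers.  If [1 + l >= b], then
[1 + l ^ k >= 1 - (1 - b) ^ k]; for [b = g / 4] this is at least a quarter of
[u = 1 - (1 - g) ^ k], and for [b = 1 / d] it is at least [1 / d].  The stated
bound is [-1 + u ^ 4 * D / 2 ^ 16] with [D = d ^ (- 8 k) <= 1 / d]. *)
Lemma lower_bound_odd_root (k : nat) : (0 < k)%N -> odd k ->
  odd_root k (-1 + 1 / (2 ^+ 12 * d%:R ^+ (8 * k)) *
                     (1 / 2 * (1 - (1 - g) ^+ k)) ^+ 4) < l.
Proof.
move=> k0 ok; apply: odd_root_lt => //.
have g1 : 0 <= g <= 1 by move: g_bounds => /andP[? ?]; apply/andP; split; lra.
have /andP[u0 u4] := one_sub_exp_le4 k g1.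
have u1 : 1 - (1 - g) ^+ k <= 1.
  by rewrite gerBl exprn_ge0//; move: g1 => /andP[? ?]; lra.
set u := 1 - (1 - g) ^+ k in u0 u4 u1 *.
have lb b : b <= 1 + l -> -1 + (1 - (1 - b) ^+ k) <= l ^+ k.
  move=> bl; have : b - 1 <= l by lra.
  move/(ler_odd_exp ok); rewrite -opprB exprNn -signr_odd ok expr1 mulN1r.
  by move=> ?; lra.
have lk : -1 < l ^+ k.
  rewrite lt_neqAle -[X in X <= _](_ : (-1) ^+ k = -1) ?ler_odd_exp ?(ltW l_gtN1)//; last first.
    by rewrite -signr_odd ok expr1.
  rewrite andbT; apply/eqP => lk; have := odd_root_unique ok (esym lk).
  have : odd_root k (-1 : R) = -1 by apply: odd_root_unique => //; rewrite -signr_odd ok.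
  by move=> -> E; move: l_gtN1; rewrite -E ltxx.
pose D : R := d%:R^-1 ^+ (8 * k).
have D0 : 0 < D by rewrite exprn_gt0//; case/andP: invd.
have D1 : D <= d%:R^-1.
  rewrite /D; case: k k0 {ok u0 u4 u1 u lb lk D D0} => // k _; rewrite mulnS addSn exprS.
  by case/andP: invd => i0 i1; rewrite ger_pMr// exprn_ile1// ltW.
have -> : 1 / (2 ^+ 12 * d%:R ^+ (8 * k)) * (1 / 2 * u) ^+ 4 = u ^+ 4 * D / 2 ^+ 16.
  have c0 : (2 ^+ 12 : R) != 0 by rewrite expf_neq0 ?pnatr_eq0.
  have E0 : (d%:R ^+ (8 * k) : R) != 0 by rewrite expf_neq0 ?pnatr_eq0 -?lt0n.
  rewrite /D exprVn -[16%N]/(12 + 4)%N exprD; move: (2 ^+ 12) (_ ^+ (8 * k)) c0 E0 => c E c0 E0.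
  by field; rewrite c0 E0.
have /andP[w0 wu] : 0 <= u ^+ 4 <= u.
  by rewrite exprn_ge0//= exprS ler_piMr ?exprn_ile1.
have c8 : 8 <= 2 ^+ 16 :> R.
  by apply: le_trans (_ : 2 ^+ 3 <= _); [lra | rewrite ler_weXn2l ?ler1n].
have Xle (t : R) : 0 <= t -> u ^+ 4 * D <= t -> u ^+ 4 * D / 2 ^+ 16 <= t / 8.
  move=> t0 ut; rewrite ler_pdivrMr ?exprn_gt0//; apply: le_trans ut _.
  by rewrite -mulrA ler_peMr//; lra.
move: invd => /andP[i0 i1]; case: gap => /lb lkb.
- have uX : u ^+ 4 * D <= u by nra.
  (* for [u = 0] strictness comes from [l > -1] instead *)
  have [uz|un] := eqVneq u 0; first by rewrite uz expr0n !mul0r addr0.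
  have upos : 0 < u by rewrite lt_neqAle eq_sym un.
  by have := Xle _ u0 uX; lra.
- have uX : u ^+ 4 * D <= d%:R^-1 by nra.
  have := Xle _ (ltW i0) uX; have := @one_sub_exp_ge k d%:R^-1 k0.
  by rewrite (ltW i0) i1 => /(_ isT); lra.
Qed.

End Numerics.

(** * Twisted Cayley graphs and sum graphs *)

Section TwistedCayley.
Variables (gT : finGroupType) (S : {set gT}) (sigma : {perm gT}).
Hypothesis hsigma : sigma \in Aut [set: gT].

Let sigmaM x y : sigma (x * y)%g = (sigma x * sigma y)%g.
Proof. by have /morphism.morphicP := Aut_morphic hsigma; apply; rewrite inE. Qed.

Lemma card_exists_eq (f : gT -> gT) : injective f ->
  #|[set y | [exists s in S, y == f s]]| = #|S|.
Proof.
move=> f_inj; suff -> : [set y | [exists s in S, y == f s]] = f @: S by rewrite card_imset.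
by apply/setP => y; rewrite inE; apply/exists_inP/imsetP => -[s sS] => [/eqP|] ->; exists s.
Qed.

Lemma twisted_cayley_degree x : #|[set y | twisted_cayley S sigma x y]| = #|S|.
Proof. by apply: card_exists_eq => s t /perm_inj/mulgI. Qed.

Lemma twisted_cayley_sum_degree x : #|[set y | twisted_cayley_sum S sigma x y]| = #|S|.
Proof. by apply: card_exists_eq => s t /perm_inj/mulgI. Qed.

(** [sigma (g x s) = sigma g * sigma (x s)]: pair the left translation by [g]
with the one by [sigma g]. *)
Lemma twisted_cayley_transitive x y : exists a c : {perm gT},
  a x = y /\ twofold_automorphism (twisted_cayley S sigma) a c.
Proof.
pose g := (y * x^-1)%g.
exists (perm (@mulgI _ g)), (perm (@mulgI _ (sigma g))); split.
  by rewrite permE /g mulgKV.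
move=> u v; rewrite !permE /twisted_cayley; apply: eq_existsb => s.
by rewrite -mulgA (sigmaM g) (inj_eq (@mulgI _ _)).
Qed.

(** [sigma ((x g)^-1 s) = sigma (g^-1) * sigma (x^-1 s)]: pair the right
translation by [g] with the left one by [sigma (g^-1)]. *)
Lemma twisted_cayley_sum_transitive x y : exists a c : {perm gT},
  a x = y /\ twofold_automorphism (twisted_cayley_sum S sigma) a c.
Proof.
pose g := (x^-1 * y)%g.
exists (perm (@mulIg _ g)), (perm (@mulgI _ (sigma g^-1%g))); split.
  by rewrite permE /g mulKVg.
move=> u v; rewrite !permE /twisted_cayley_sum; apply: eq_existsb => s.
by rewrite (invMg u) -mulgA (sigmaM g^-1%g) (inj_eq (@mulgI _ _)).
Qed.

End TwistedCayley.

Theorem theorem1p1 (R : realType) (gT : finGroupType) (S : {set gT}) (d : nat)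
    (hd : #|S| = d) (sigma : {perm gT}) (hsigma : sigma \in Aut [set: gT]) :
  [/\ (sigma ^+ 2 = 1)%g ->
      connected (twisted_cayley S sigma) ->
      undirected (twisted_cayley S sigma) ->
      (4 <= #|gT|)%N ->
      let h : R := vertex_cheeger R (twisted_cayley S sigma) in
      (nontrivial_spectrum R d (twisted_cayley S sigma) `<=`
         `]-1 + h ^+ 4 / (2 ^+ 12 * d%:R ^+ 8),
                 1 - h ^+ 2 / (2 * d%:R ^+ 2)])%classic,
      forall k : nat, (1 <= k)%N -> odd k ->
      (sigma ^+ (2 * k) = 1)%g ->
      connected (twisted_cayley S sigma) ->
      undirected (twisted_cayley S sigma) ->
      (4 <= #|gT|)%N ->
      let h : R := vertex_cheeger R (twisted_cayley S sigma) in
      (nontrivial_spectrum R d (twisted_cayley S sigma) `<=`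
         `]odd_root k
                   (-1 + 1 / (2 ^+ 12 * d%:R ^+ (8 * k)) *
                     (1 / 2 * (1 - (1 - h ^+ 2 / (2 * d%:R ^+ 2)) ^+ k)) ^+ 4),
                 1 - h ^+ 2 / (2 * d%:R ^+ 2)])%classic
    & connected (twisted_cayley_sum S sigma) ->
      undirected (twisted_cayley_sum S sigma) ->
      (4 <= #|gT|)%N ->
      let h : R := vertex_cheeger R (twisted_cayley_sum S sigma) in
      (nontrivial_spectrum R d (twisted_cayley_sum S sigma) `<=`
         `]-1 + h ^+ 4 / (2 ^+ 12 * d%:R ^+ 8),
                 1 - h ^+ 2 / (2 * d%:R ^+ 2)])%classic].
Proof.
(* With g = h ^ 2 / (2 d ^ 2), the stated quartic term is g ^ 2 / (2 ^ 10 d ^ 4). *)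
have quarticE (h : R) : (0 < d)%N ->
    h ^+ 4 / (2 ^+ 12 * d%:R ^+ 8) =
    (h ^+ 2 / (2 * d%:R ^+ 2) * d%:R^-1 ^+ 2) ^+ 2 / 2 ^+ 10.
  by move=> d0; field; rewrite pnatr_eq0 -lt0n.
split.
- move=> _ conn sym /ltnW/ltnW n2 h l lspec.
  have deg x := etrans (twisted_cayley_degree S sigma x) hd.
  have d0 := connected_degree_gt0 deg conn n2.
  have [lN1 lup gb gap] := nontrivial_spectrum_bounds deg conn sym n2
    (twisted_cayley_transitive S hsigma) lspec.
  by rewrite /= in_itv /= lup andbT quarticE// lower_bound_quartic.
- move=> k k0 ok _ conn sym /ltnW/ltnW n2 h l lspec.
  have deg x := etrans (twisted_cayley_degree S sigma x) hd.
  have d0 := connected_degree_gt0 deg conn n2.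
  have [lN1 lup gb gap] := nontrivial_spectrum_bounds deg conn sym n2
    (twisted_cayley_transitive S hsigma) lspec.
  by rewrite /= in_itv /= lup andbT lower_bound_odd_root.
- move=> conn sym /ltnW/ltnW n2 h l lspec.
  have deg x := etrans (twisted_cayley_sum_degree S sigma x) hd.
  have d0 := connected_degree_gt0 deg conn n2.
  have [lN1 lup gb gap] := nontrivial_spectrum_bounds deg conn sym n2
    (twisted_cayley_sum_transitive S hsigma) lspec.
  by rewrite /= in_itv /= lup andbT quarticE// lower_bound_quartic.
Qed.
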